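(* Let $n$ and $k$ be given positive integers. Then, as functions of the positive integer $d$, both $$\sum_{\lambda\in \mathcal{C}_{n,dn+1}}|\lambda|^k \qquad\text{and}\qquad \sum_{\lambda\in \mathcal{C}_{n,dn-1}}|\lambda|^k$$ are polynomials in $d$ of degree at most $2k+\lfloor n/2\rfloor$.
   Context: A partition $\lambda=(\lambda_1\ge\dots\ge\lambda_\ell)$ has size $|\lambda|=\sum_i\lambda_i$. The hook length of a box of its Young diagram is the number of boxes directly to its right, directly below it, plus the box itself. For a positive integer $t$, $\lambda$ is a $t$-core if none of its hook lengths is divisible by $t$; an $(s,t)$-core is both an $s$-core and a $t$-core. $\mathcal{C}_{n,dn+1}$ (resp. $\mathcal{C}_{n,dn-1}$) denotes the set of $(n,dn+1)$-core (resp. $(n,dn-1)$-core) partitions with distinct parts. *)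

(* Defs.v *)
From mathcomp Require Import all_boot all_order all_algebra.
From mathcomp Require Import all_classical.

Set Implicit Arguments.
Unset Strict Implicit.
Unset Printing Implicit Defensive.

Local Open Scope nat_scope.

(* A partition is the weakly decreasing list of its (positive) parts; the
   empty list is the empty partition, and the size |la| is [sumn la]. *)
Definition is_partition (la : seq nat) : bool := sorted geq la && (0 \notin la).

(* The box (i, j) is in row i and column j, both numbered from 0. *)
Definition young_diagram (la : seq nat) : seq (nat * nat) :=
  [seq (i, j) | i <- iota 0 (size la), j <- iota 0 (nth 0 la i)].

Definition arm_length (la : seq nat) (b : nat * nat) : nat :=
  count (fun c => (c.1 == b.1) && (b.2 < c.2)) (young_diagram la).

Definition leg_length (la : seq nat) (b : nat * nat) : nat :=
  count (fun c => (c.2 == b.2) && (b.1 < c.1)) (young_diagram la).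

Definition hook_length (la : seq nat) (b : nat * nat) : nat :=
  arm_length la b + leg_length la b + 1.

(* Hook lengths are positive, so every partition is a 0-core. *)
Definition is_core (t : nat) (la : seq nat) : bool :=
  all (fun b => ~~ (t %| hook_length la b)) (young_diagram la).

Definition distinct_cores (s t : nat) : set (seq nat) :=
  [set la | [/\ is_partition la, uniq la, is_core s la & is_core t la]]%classic.

(* Main.v *)
(** The first-column hook lengths of a partition form its beta-set, and the
    hook lengths in the row of b are the b - m with m < b outside the beta-set.
    Hence an n-core is an n-flush beta-set, given by the number a_i of beads on
    each runner i mod n, with a_0 = 0.  Distinct parts mean that the beta-set
    has no two consecutive elements, i.e. a_i a_(i+1) = 0, and then being a
    (dn+1)-core just says a_i <= d, while being a (dn-1)-core says in addition
    a_(n-1) <= d - 1.  As |la| is a quadratic polynomial in the a_i, the k-th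
    power sum is, for each of the supports S of a (where #|S| <= n/2), the sum
    of a polynomial of degree 2k over a box of dimension #|S| and side about d. *)

Require Import Defs.
From mathcomp Require Import all_boot all_order all_algebra.
From mathcomp Require Import all_classical.
From mathcomp Require Import zify ring.

Import GRing.Theory Num.Theory.
Local Open Scope ring_scope.

(** * Partitions and their beta-sets *)

Section Combinatorics.
Local Open Scope nat_scope.
Set Implicit Arguments.
Unset Strict Implicit.

(* The first-column hook lengths of [la], in decreasing order. *)
Fixpoint beta (la : seq nat) : seq nat :=
  if la is x :: la' then x + size la' :: beta la' else [::].

Fixpoint unbeta (s : seq nat) : seq nat :=
  if s is b :: s' then b - size s' :: unbeta s' else [::].

Lemma size_beta la : size (beta la) = size la.
Proof. by elim: la => //= x la ->. Qed.

Lemma size_unbeta s : size (unbeta s) = size s.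
Proof. by elim: s => //= x s ->. Qed.

Lemma betaK : cancel beta unbeta.
Proof. by elim=> //= x la ->; rewrite size_beta addnK. Qed.

Lemma geq_trans : transitive geq.
Proof. by move=> b a c /= ab bc; apply: leq_trans bc ab. Qed.

Lemma gtn_trans : transitive gtn.
Proof. by move=> b a c /= ab bc; apply: ltn_trans bc ab. Qed.

(** A strictly decreasing list of positive integers drops by at least one at each step. This is why
    the subtraction in [unbeta] does not truncate and leaves positive parts. *)
Lemma sorted_gtn_size b s : path gtn b s -> 0 \notin b :: s -> size s < b.
Proof.
elim: s b => [|x s IH] b /=; first by rewrite inE lt0n eq_sym.
case/andP=> xb px; rewrite inE negb_or => /andP[_ /(IH _ px)].
by move=> h; apply: leq_ltn_trans xb.
Qed.

Lemma unbetaK s : sorted gtn s -> 0 \notin s -> beta (unbeta s) = s.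
Proof.
elim: s => //= b s IH ps s0.
have sz := sorted_gtn_size ps s0.
move: s0; rewrite inE negb_or => /andP[_ s0].
by rewrite size_unbeta IH ?(path_sorted ps) // subnK // ltnW.
Qed.

(** Neighbouring entries of [beta la] differ by one more than the corresponding parts of [la], so
    distinct parts turn into gaps of at least 2. *)
Definition gap2 (x y : nat) := y.+1 < x.

Lemma gap2_trans : transitive gap2.
Proof. rewrite /gap2 => b a c; lia. Qed.

Lemma beta_gap2 la : sorted gtn la -> sorted gap2 (beta la).
Proof.
elim: la => //= x [//|y la] IH /= /andP[yx p].
by have /= -> := IH p; rewrite andbT /gap2 /=; lia.
Qed.

Lemma unbeta_gtn s : sorted gap2 s -> 0 \notin s -> sorted gtn (unbeta s).
Proof.
elim: s => //= x [//|y s] IH /= /andP[yx p] s0.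
have /= := IH p; rewrite inE negb_or in s0; case/andP: s0 => _ s0.
move=> -> //; rewrite andbT.
have : path gtn y s by apply: (@sub_path _ gap2 gtn _ y s p) => a b /ltnW.
move=> /sorted_gtn_size /(_ s0); rewrite /gap2 in yx; lia.
Qed.

Lemma unbeta_pos s : sorted gtn s -> 0 \notin s -> 0 \notin unbeta s.
Proof.
elim: s => //= x s IH p s0.
have := sorted_gtn_size p s0; move: s0; rewrite !inE !negb_or => /andP[_ s0].
by rewrite (IH (path_sorted p) s0) andbT eq_sym subn_eq0 -ltnNge.
Qed.

Lemma beta_pos la : 0 \notin la -> 0 \notin beta la.
Proof.
elim: la => //= x la IH; rewrite !inE !negb_or => /andP[x0 /IH ->].
by rewrite andbT eq_sym addn_eq0 eq_sym (negbTE x0).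
Qed.

Lemma distinct_partitionE la :
  is_partition la && uniq la = sorted gtn la && (0 \notin la).
Proof.
rewrite /is_partition andbAC; congr andb.
by rewrite gtn_sorted_uniq_geq andbC.
Qed.

Lemma gap2P s : sorted gap2 s <->
  sorted gtn s /\ forall x, x \in s -> x.+1 \notin s.
Proof.
split=> [gs|[gs cs]]; last first.
  apply: (@sub_in_sorted _ (mem s) gtn) gs; last exact/allP.
  move=> a b /= ina inb ab; rewrite /gap2.
  case: (ltngtP b.+1 a) => // [|E]; first by rewrite ltnS leqNgt ab.
  by have := cs b inb; rewrite E ina.
have gtns : sorted gtn s by apply: sub_sorted gs => a b /ltnW.
split=> // x; elim: s gs gtns => //= y s IH py qy.
have Hall := order_path_min gap2_trans py.
rewrite !inE => /orP[/eqP->|xs].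
  rewrite negb_or gtn_eqF //=; apply/negP => /(allP Hall); rewrite /gap2; lia.
have /= := allP Hall x xs; rewrite /gap2 => h.
by rewrite negb_or (ltn_eqF h) /= IH // ?(path_sorted py) ?(path_sorted qy).
Qed.

Lemma sumn_beta la : sumn (beta la) = sumn la + 'C(size la, 2).
Proof. by elim: la => //= x la ->; rewrite binS bin1; lia. Qed.

(** * Hook lengths read off the beta-set *)

Lemma young_diagram_cons x la : young_diagram (x :: la) =
  [seq (0, j) | j <- iota 0 x] ++ [seq (c.1.+1, c.2) | c <- young_diagram la].
Proof.
rewrite /young_diagram /=; congr cat.
rewrite (iotaDl 1 0 (size la)) allpairs_mapl map_allpairs.
by [].
Qed.

Lemma count_iota_gt j x : count (fun c => j < c) (iota 0 x) = x - j.+1.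
Proof. by elim: x => // x IH; rewrite -{1}[x.+1]addn1 iotaD count_cat IH /=; lia. Qed.

Lemma count_iota_eq j x : count (pred1 j) (iota 0 x) = (j < x).
Proof. by rewrite count_uniq_mem ?iota_uniq // mem_iota add0n. Qed.

Lemma count_column j la :
  count (fun c => c.2 == j) (young_diagram la) = count (fun y => j < y) la.
Proof.
elim: la => // x la IH; rewrite young_diagram_cons count_cat !count_map /= -IH.
by rewrite -count_iota_eq; congr (_ + _); apply: eq_count.
Qed.

Lemma hook_length_first x la j : j < x ->
  hook_length (x :: la) (0, j) = x - j + count (fun y => j < y) la.
Proof.
move=> jx; rewrite /hook_length /arm_length /leg_length young_diagram_cons /=.
rewrite !count_cat !count_map -count_column.
(* The four counts are the arm in the first row, the arm below it, the leg in the first row and the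
   leg below it; the two middle ones vanish. *)
transitivity ((x - j.+1 + 0) + (0 + count (fun c => c.2 == j) (young_diagram la)) + 1).
  congr ((_ + _) + (_ + _) + 1).
  - by rewrite -count_iota_gt; apply: eq_count.
  - by rewrite -[RHS](count_pred0 (young_diagram la)); apply: eq_count.
  - by rewrite -[RHS](count_pred0 (iota 0 x)); apply: eq_count => c /=; rewrite andbF.
  - by apply: eq_count => c /=; rewrite andbT.
lia.
Qed.

Lemma hook_length_shift x la i j :
  hook_length (x :: la) (i.+1, j) = hook_length la (i, j).
Proof.
rewrite /hook_length /arm_length /leg_length young_diagram_cons /=.
rewrite !count_cat !count_map; congr (_ + _ + _).
  by rewrite (@eq_count _ _ pred0) ?count_pred0 //; apply: eq_count.
by rewrite (@eq_count _ _ pred0) ?count_pred0 // => c /=; rewrite andbF.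
Qed.

(* [j] runs through the columns: the right-hand side is the position of the
   horizontal boundary step under column [j]. *)
Lemma notin_beta la m : sorted geq la ->
  (m \notin beta la) <-> exists j, m = j + count (fun y => y <= j) la.
Proof.
elim: la => [_|x la IH /= p]; first by split=> // _; exists m; rewrite /= addn0.
have xla : all (geq x) la := order_path_min geq_trans p.
have {}IH := IH (path_sorted p).
have big j : x <= j -> count (fun y => y <= j) la = size la.
  move=> xj; apply/eqP; rewrite -all_count; apply/allP => y /(allP xla) /= yx.
  exact: leq_trans yx xj.
rewrite inE negb_or; split.
  case/andP=> /eqP mx /IH[j mj].
  have [xj|jx] := leqP x j; last by exists j; rewrite mj leqNgt jx.
  (* The new part [x] raises the count by one at every [j >= x], so the witness drops to [j.-1]. The
     case [j = x] cannot occur, because [m] differs from the new entry [x + size la]. *)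
  have xj1 : x <= j.-1 by move: mx; rewrite mj (big _ xj); lia.
  exists j.-1; rewrite (big _ xj1) xj1 mj (big _ xj).
  by move: mx; rewrite mj (big _ xj); lia.
case=> j; have [xj|jx] := leqP x j; rewrite /= ?add0n => mj.
  move: mj; rewrite big // => mj; apply/andP; split; first by apply/eqP; lia.
  by apply/IH; exists j.+1; rewrite big; lia.
apply/andP; split; last by apply/IH; exists j.
have := count_size (fun y => y <= j) la; apply: contraTneq; lia.
Qed.

Lemma beta_lt x la b : b \in beta la -> all (geq x) la -> b < x + size la.
Proof.
elim: la => //= y la IH; rewrite inE => /orP[/eqP-> /andP[yx _]|/IH h /andP[_ /h]].
  by rewrite addnS ltnS leq_add2r.
by rewrite addnS => /ltnW.
Qed.

(** Induction on the rows. Removing the first row keeps the hook lengths below it and removes the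
    largest entry [x + size la] from the beta-set. By [rowE] the first-row hooks are the distances
    from that entry to the boundary steps under the columns [j < x], and [notin_beta] says that
    these steps are the non-entries below it. *)
Lemma is_coreP t la : sorted geq la ->
  reflect (forall b m, b \in beta la -> m < b -> m \notin beta la ->
             ~~ (t %| b - m))
          (is_core t la).
Proof.
elim: la => [_|x la IH /= p]; first by apply: (iffP idP).
have xla : all (geq x) la := order_path_min geq_trans p.
have pla := path_sorted p.
have big j : x <= j -> count (fun y => y <= j) la = size la.
  move=> xj; apply/eqP; rewrite -all_count; apply/allP => y /(allP xla) /= yx.
  exact: leq_trans yx xj.
have rowE j : j < x -> x + size la - (j + count (fun y => y <= j) la) =
                       hook_length (x :: la) (0, j).
  move=> jx; rewrite hook_length_first //.
  have := count_predC (fun y => y <= j) la.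
  rewrite (@eq_count _ (predC _) (fun y => j < y)); first lia.
  by move=> y /=; rewrite ltnNge.
have step : is_core t (x :: la) =
    all (fun j => ~~ (t %| hook_length (x :: la) (0, j))) (iota 0 x)
    && is_core t la.
  rewrite /is_core young_diagram_cons all_cat !all_map; congr andb.
  by apply: eq_all => -[i j] /=; rewrite hook_length_shift.
rewrite step; apply: (iffP andP) => [[/allP row /(IH pla) core] b m|H].
  rewrite !inE => /orP[/eqP->|hb] mb; rewrite negb_or => /andP[mx hm].
    case/notin_beta: hm => // j mj.
    have jx : j < x by rewrite ltnNge; apply/negP => xj; move: mb; rewrite mj big; lia.
    by rewrite mj rowE // row // mem_iota.
  exact: core.
split.
  apply/allP => j; rewrite mem_iota add0n /= => jx; rewrite -rowE //.
  have := count_size (fun y => y <= j) la => cs.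
  apply: H; rewrite ?inE ?eqxx //; first lia.
  rewrite negb_or; apply/andP; split; first by apply/eqP; lia.
  by apply/notin_beta => //; exists j.
apply/(IH pla) => b m hb mb hm; apply: H => //; rewrite inE ?hb ?orbT //.
(* The new head exceeds every entry of [beta la], hence exceeds [b] and [m]. *)
rewrite negb_or hm andbT; apply/eqP => E.
by have := beta_lt hb xla; lia.
Qed.

(** * Distinct-part cores on the abacus *)

Lemma find_threshold (p : pred nat) d j :
    (forall k, p k.+1 -> p k) -> (forall k, p k -> k < d) ->
  (j < find (predC p) (iota 0 d)) = p j.
Proof.
move=> pS pd.
have pW i k : i <= k -> p k -> p i.
  move=> ik; rewrite -(subnKC ik); elim: (k - i) => [|l IH].
    by rewrite addn0.
  by rewrite addnS => /pS.
apply/idP/idP => [jf|pj].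
  have jd : j < d by apply: leq_trans jf _; rewrite -[d in _ <= d](size_iota 0) find_size.
  by have /negbFE := before_find 0 jf; rewrite nth_iota.
rewrite ltnNge; apply/negP => fj.
have fd := leq_ltn_trans fj (pd _ pj).
have /(nth_find 0) : has (predC p) (iota 0 d) by rewrite has_find size_iota.
by rewrite nth_iota //= add0n (pW _ j).
Qed.

(* [a i] beads pushed up on runner [i] of an (n+1)-runner abacus. *)
Definition beads n d (a : {ffun 'I_n.+1 -> 'I_d.+1}) : seq nat :=
  [seq x <- rev (iota 0 (d * n.+1)) | x %/ n.+1 < a (inord (x %% n.+1))].

(* [u] selects the (dN-1)-cores, N = n+1, rather than the (dN+1)-cores. *)
Definition admissible n d (u : bool) (a : {ffun 'I_n.+1 -> 'I_d.+1}) : bool :=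
  [&& a ord0 == 0 :> nat,
      [forall i : 'I_n.+1, forall j : 'I_n.+1,
        (j == i.+1 :> nat) ==> (a i == 0 :> nat) || (a j == 0 :> nat)] &
      [forall i : 'I_n.+1, a i <= d - (u && (i == n :> nat))]].

Lemma admissibleP n d u (a : {ffun 'I_n.+1 -> 'I_d.+1}) :
  reflect [/\ a ord0 = 0 :> nat,
            forall i j : 'I_n.+1, j = i.+1 :> nat -> 0 < a i -> 0 < a j -> False &
            forall i : 'I_n.+1, a i <= d - (u && (i == n :> nat))]
          (admissible u a).
Proof.
apply: (iffP and3P) => [[/eqP a0 /forallP as_ /forallP ab]|[a0 as_ ab]]; split=> //.
- move=> i j /eqP ij; have /forallP/(_ j) := as_ i; rewrite ij /=.
  by case/orP=> /eqP ->.
- exact/eqP.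
- apply/forallP => i; apply/forallP => j; apply/implyP => /eqP ij.
  rewrite !eqn0Ngt -negb_and; apply/negP => /andP[]; exact: as_ ij.
- exact/forallP.
Qed.

(* [d * n.+1 - 1] is 0 when [d = 1] and [n = 0]; every partition is a 0-core. *)
Definition modulus n d (u : bool) := if u then d * n.+1 - 1 else d * n.+1 + 1.

Lemma mem_beads n d (a : {ffun 'I_n.+1 -> 'I_d.+1}) x :
  (x \in beads a) = (x %/ n.+1 < a (inord (x %% n.+1))).
Proof.
rewrite mem_filter mem_rev mem_iota add0n /= andb_idr // => xa.
by rewrite -ltn_divLR //; apply: leq_trans xa _; rewrite -ltnS.
Qed.

Lemma sorted_beads n d (a : {ffun 'I_n.+1 -> 'I_d.+1}) : sorted gtn (beads a).
Proof.
apply: sorted_filter; first exact: gtn_trans.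
by rewrite rev_sorted iota_ltn_sorted.
Qed.

Lemma beads_inj n d : injective (@beads n d).
Proof.
move=> a b eq_ab; apply/ffunP => i; apply/val_inj => /=.
have E j : (j < a i) = (j < b i).
  have := mem_beads a (j * n.+1 + i); rewrite eq_ab mem_beads.
  rewrite !divnMDl // !modnMDl !divn_small ?modn_small // addn0.
  by rewrite inord_val.
by apply/eqP; rewrite eqn_leq leqNgt E -leqNgt leqnn leqNgt -E -leqNgt leqnn.
Qed.

(** Cut the interval below [d * n.+1] into [d] rows of length [n.+1], then exchange rows and
    runners. *)
Lemma sum_beads n d (a : {ffun 'I_n.+1 -> 'I_d.+1}) (G : nat -> nat) :
  \sum_(x <- beads a) G x =
  \sum_(i < n.+1) \sum_(j < a i) G (j * n.+1 + i).
Proof.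
rewrite /beads big_filter (perm_big (iota 0 (d * n.+1))) ?perm_rev //=.
pose F x := if x %/ n.+1 < a (inord (x %% n.+1)) then G x else 0.
have rowE j : \sum_(j * n.+1 <= x < j.+1 * n.+1) F x =
    \sum_(i < n.+1) if j < a i then G (j * n.+1 + i) else 0.
  rewrite -{1}[j * n.+1]add0n big_addn mulSn addnK big_mkord.
  apply: eq_bigr => i _; rewrite /F addnC divnMDl // modnMDl divn_small //.
  by rewrite modn_small // addn0 inord_val.
have -> : iota 0 (d * n.+1) = index_iota 0 (d * n.+1) by rewrite /index_iota subn0.
rewrite big_mkcond big_nat_mul (eq_bigr _ (fun j _ => rowE j)) big_mkord.
rewrite exchange_big; apply: eq_bigr => i _; rewrite -big_mkcond /=.
by rewrite (big_ord_narrow_cond _ (P := xpredT)) //; rewrite -ltnS.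
Qed.

Lemma beads_pos n d u (a : {ffun 'I_n.+1 -> 'I_d.+1}) :
  admissible u a -> 0 \notin beads a.
Proof.
case/admissibleP => a0 _ _; rewrite mem_beads div0n mod0n -leqNgt.
by rewrite -[inord 0]/(inord (ord0 : 'I_n.+1)) inord_val a0.
Qed.

(** By [sumn_beta], the sum of the beads exceeds the size of the partition by a binomial coefficient
    in the number of beads; the right-hand side is the sum of the beads, runner by runner. The
    additive form avoids truncated subtraction. *)
Lemma sumn_unbeta_beads n d u (a : {ffun 'I_n.+1 -> 'I_d.+1}) : admissible u a ->
  sumn (unbeta (beads a)) + 'C(\sum_i a i, 2) =
  \sum_i (a i * i + 'C(a i, 2) * n.+1).
Proof.
move=> aa.
have szB : size (beads a) = \sum_i a i.
  rewrite -sum1_size (sum_beads a (fun=> 1)); apply: eq_bigr => i _.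
  by rewrite sum1_card card_ord.
rewrite -szB -size_unbeta -sumn_beta unbetaK ?sorted_beads ?(beads_pos aa) // sumnE.
rewrite (sum_beads a id); apply: eq_bigr => i _.
rewrite big_split /= sum_nat_const card_ord -big_distrl /= addnC.
by rewrite -(big_mkord xpredT id) bin2_sum.
Qed.

Lemma beads_core n d u (a : {ffun 'I_n.+1 -> 'I_d.+1}) : 0 < d ->
  admissible u a -> distinct_cores n.+1 (modulus n d u) (unbeta (beads a)).
Proof.
move=> d0 aa; have B0 := beads_pos aa; case/admissibleP: aa => a0 as_ ab.
have a0' : a (inord 0) = 0 :> nat.
  by rewrite -[inord 0]/(inord (ord0 : 'I_n.+1)) inord_val.
have gB : sorted gap2 (beads a).
  apply/gap2P; split=> [|x]; first exact: sorted_beads.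
  rewrite mem_beads => hx; rewrite mem_beads; apply/negP => hx1.
  have lx : x %% n.+1 < n.+1 by rewrite ltn_mod.
  (* After the last runner, [x.+1] returns to runner 0, which is empty. *)
  have [E|ne] := eqVneq (x %% n.+1).+1 n.+1.
    by move: hx1; rewrite {1 2}(divn_eq x n.+1) -addnS E -mulSnr modnMl a0' ltn0.
  have lx1 : (x %% n.+1).+1 < n.+1 by rewrite ltn_neqAle ne.
  have E : x.+1 %% n.+1 = (x %% n.+1).+1.
    by rewrite {1}(divn_eq x n.+1) -addnS modnMDl modn_small.
  apply: (as_ (inord (x %% n.+1)) (inord (x.+1 %% n.+1))).
  - by rewrite !inordK // E.
  - exact: leq_ltn_trans hx.
  - exact: leq_ltn_trans hx1.
have gla := unbeta_gtn gB B0.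
have sla : sorted geq (unbeta (beads a)).
  by apply: sub_sorted gla => x y /ltnW.
have bla := unbetaK (sorted_beads a) B0.
have : is_partition (unbeta (beads a)) && uniq (unbeta (beads a)).
  by rewrite distinct_partitionE gla unbeta_pos // sorted_beads.
case/andP=> p1 p2; split=> //; apply/(is_coreP _ sla) => b m; rewrite bla.
  (* Here [m] lies on the runner of [b] at a smaller height, so it would be a bead as well. *)
  rewrite !mem_beads => hb mb hm; apply/negP => /dvdnP[q bm].
  have E : b = q * n.+1 + m by lia.
  move: hm hb; rewrite E divnMDl // modnMDl; lia.
rewrite !mem_beads => hb mb hm; apply/negP => tbm.
(* All beads lie below [d * n.+1], which leaves no difference as large as [d * n.+1 + 1]. A
   difference of at least [d * n.+1 - 1] forces [b] to be the top position of runner [n], excluded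
   by the sharper bound there. *)
have bd : b < d * n.+1.
  by rewrite -ltn_divLR //; apply: leq_trans hb _; rewrite -ltnS.
have := dvdn_leq _ tbm; rewrite subn_gt0 => /(_ mb); rewrite /modulus.
case: u ab tbm => [ab tbm le|_ _]; last lia.
have E : b = d.-1 * n.+1 + n.
  by have := mulSnr d.-1 n.+1; rewrite prednK //; lia.
move: hb; rewrite E divnMDl // modnMDl divn_small // modn_small // addn0.
have /= := ab ord_max; rewrite eqxx.
have -> : inord n = ord_max :> 'I_n.+1 by apply/val_inj; rewrite /= inordK.
lia.
Qed.

Lemma core_beads n d u la : 0 < d -> distinct_cores n.+1 (modulus n d u) la ->
  exists2 a : {ffun 'I_n.+1 -> 'I_d.+1}, admissible u a & beta la = beads a.
Proof.
move=> d0 [p1 p2 c1 c2].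
have /andP[gla la0] : sorted gtn la && (0 \notin la).
  by rewrite -distinct_partitionE p1.
have sla : sorted geq la by case/andP: p1.
have B0 := beta_pos la0.
have [gB cB] := (gap2P _).1 (beta_gap2 gla).
have flush1 b m : b \in beta la -> m < b -> n.+1 %| b - m -> m \in beta la.
  by move=> hb mb; apply: contraTT; apply: (is_coreP _ sla c1).
have flush2 b m : b \in beta la -> m < b -> modulus n d u %| b - m -> m \in beta la.
  by move=> hb mb; apply: contraTT; apply: (is_coreP _ sla c2).
(* From an entry that is too large, the two moduli lead down to two entries differing by 1, which
   distinct parts forbid. That neither jump lands on 0 is what makes the second one possible. *)
have bound x : x \in beta la -> x < d * n.+1 - u.
  move=> hx; rewrite ltnNge; apply/negP => le.
  have x0 : 0 < x by rewrite lt0n; apply: contraNneq B0 => <-.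
  have dn0 : 0 < d * n.+1 by rewrite muln_gt0 d0.
  case: u flush2 le {c2} => flush2 le.
    (* The second modulus is then 0 and gives no information, but [n.+1 = 1] and a 1-core is
       empty. *)
    have [dn1|dn1] := eqVneq (d * n.+1) 1.
      have n0 : n.+1 = 1 by move/eqP: dn1; rewrite muln_eq1 => /andP[_ /eqP].
      by move: B0; rewrite (flush1 x 0) // n0 dvd1n.
    have h1 : x - (d * n.+1 - 1) \in beta la.
      by apply: (flush2 x) => //; rewrite /modulus; [lia | rewrite subKn].
    have xne : x != d * n.+1 - 1.
      by apply: contraNneq B0 => E; move: h1; rewrite E subnn.
    have h2 : x - d * n.+1 \in beta la.
      by apply: (flush1 x) => //; [lia | rewrite subKn ?dvdn_mull //; lia].
    move: (cB _ h2); rewrite -subSn; last lia.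
    by rewrite (_ : x.+1 - d * n.+1 = x - (d * n.+1 - 1)) ?h1 //; lia.
  rewrite subn0 in le.
  have h2 : x - d * n.+1 \in beta la.
    by apply: (flush1 x) => //; [lia | rewrite subKn ?dvdn_mull //; lia].
  have xne : x != d * n.+1.
    by apply: contraNneq B0 => E; move: h2; rewrite E subnn.
  have h1 : x - (d * n.+1 + 1) \in beta la.
    by apply: (flush2 x) => //; rewrite /modulus; [lia | rewrite subKn //; lia].
  move: (cB _ h1); rewrite (_ : (x - _).+1 = x - d * n.+1) ?h2 //; lia.
pose p (i j : nat) := j * n.+1 + i \in beta la.
have pd i j : p i j -> j < d.
  move/bound => h; have {h}: j * n.+1 < d * n.+1 by lia.
  by rewrite ltn_mul2r.
have pS i j : p i j.+1 -> p i j.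
  by move/flush1; apply; rewrite mulSn; [lia | rewrite (_ : _ - _ = n.+1) //; lia].
(* The number of beads on runner [i]: by [pS] they fill an initial segment of the runner, and by
   [pd] it ends before height [d]. *)
pose f (i : 'I_n.+1) := find (predC (p i)) (iota 0 d).
have fE (i : 'I_n.+1) j : (j < f i) = (j * n.+1 + i \in beta la).
  by apply: find_threshold; [exact: pS | exact: pd].
have fd i : f i < d.+1 by rewrite ltnS -[d in _ <= d](size_iota 0) find_size.
pose a := [ffun i => Ordinal (fd i)]; exists a; last first.
  apply: irr_sorted_eq gB (sorted_beads a) _; [exact: gtn_trans | exact: ltnn |].
  move=> x; rewrite mem_beads ffunE /= fE inordK ?ltn_mod //.
  by rewrite -divn_eq.
apply/admissibleP; split=> [|i j ij|i]; rewrite ?ffunE /=.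
- by apply/eqP; rewrite eqn0Ngt fE.
- by rewrite !fE !mul0n !add0n ij => /cB/negP.
- case: (boolP (u && _)) => [/andP[u1 /eqP i1]|_] /=; last by rewrite subn0 -ltnS.
  (* A [d]-th bead on runner [n] would sit at [d * n.+1 - 1]. *)
  rewrite leqNgt fE; apply/negP => /bound; rewrite u1 i1 subn1.
  by have := mulSnr d.-1 n.+1; rewrite prednK //; lia.
Qed.

End Combinatorics.

(** * Polynomial functions of d and power sums *)

Section PolynomialSums.

(** Only positive [d] matter: at [d = 0] the truncated side length [d - 1] of a box would break
    polynomiality. *)
Definition polyle (m : nat) (h : nat -> rat) : Prop :=
  exists p : {poly rat}, (size p <= m.+1)%N /\
    forall d : nat, (0 < d)%N -> h d = p.[d%:R].

Lemma polyle_ext m h1 h2 : (forall d, (0 < d)%N -> h1 d = h2 d) ->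
  polyle m h1 -> polyle m h2.
Proof. by move=> h12 [p [sp hp]]; exists p; split=> // d d0; rewrite -h12 ?hp. Qed.

Lemma polyle_const c : polyle 0 (fun=> c).
Proof.
by exists c%:P; rewrite size_polyC; split=> [|d _]; [case: (c != 0) | rewrite hornerC].
Qed.

Lemma polyleW m1 m2 h : (m1 <= m2)%N -> polyle m1 h -> polyle m2 h.
Proof. by move=> m12 [p [sp hp]]; exists p; split=> //; apply: leq_trans sp _. Qed.

Lemma polyleD m h1 h2 : polyle m h1 -> polyle m h2 -> polyle m (fun d => h1 d + h2 d).
Proof.
move=> [p [sp hp]] [q [sq hq]]; exists (p + q); split=> [|d d0].
  by apply: leq_trans (size_polyD _ _) _; rewrite geq_max sp.
by rewrite hornerD hp ?hq.
Qed.

Lemma polyleM m1 m2 h1 h2 : polyle m1 h1 -> polyle m2 h2 ->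
  polyle (m1 + m2) (fun d => h1 d * h2 d).
Proof.
move=> [p [sp hp]] [q [sq hq]]; exists (p * q); split=> [|d d0].
  by apply: leq_trans (size_polyMleq _ _) _; lia.
by rewrite hornerM hp ?hq.
Qed.

Lemma polyle_sum (I : Type) (r : seq I) (P : pred I) m (h : I -> nat -> rat) :
  (forall i, P i -> polyle m (h i)) ->
  polyle m (fun d => \sum_(i <- r | P i) h i d).
Proof.
move=> H; elim: r => [|i r IH].
  apply: polyle_ext (polyleW (leq0n m) (polyle_const 0)) => d _.
  by rewrite big_nil.
case Pi: (P i).
  by apply: polyle_ext (polyleD (H _ Pi) IH) => d _; rewrite big_cons Pi.
by apply: polyle_ext IH => d _; rewrite big_cons Pi.
Qed.

Lemma polyle_prod (I : Type) (r : seq I) (m : I -> nat) (h : I -> nat -> rat) :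
  (forall i, polyle (m i) (h i)) ->
  polyle (\sum_(i <- r) m i) (fun d => \prod_(i <- r) h i d).
Proof.
move=> H; elim: r => [|i r IH].
  by rewrite big_nil; apply: polyle_ext (polyle_const 1) => d _; rewrite big_nil.
rewrite big_cons.
by apply: polyle_ext (polyleM (H i) IH) => d _; rewrite big_cons.
Qed.

(** Telescoping $(j+1)^{e+1}-j^{e+1}$ writes $d^{e+1}$ as a binomial combination of the power sums
    of exponents up to $e$; the top one has coefficient $e+1$ and can be solved for. *)
Lemma power_sum_polynomial e : exists p : {poly rat}, (size p <= e.+2)%N /\
  forall d : nat, \sum_(j < d) (j%:R : rat) ^+ e = p.[d%:R].
Proof.
elim/ltn_ind: e => e IH.
have [p hp] := choice (fun i : 'I_e => IH i (ltn_ord i)).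
exists ((e.+1%:R : rat)^-1 *: ('X^(e.+1) - \sum_(i < e) p i *+ 'C(e.+1, i))).
split.
  apply: leq_trans (size_scale_leq _ _) _.
  apply: leq_trans (size_polyD _ _) _; rewrite size_polyXn size_polyN geq_max leqnn /=.
  apply: leq_trans (size_sum _ _ _) _; apply/bigmax_leqP => i _.
  rewrite -scaler_nat; apply: leq_trans (size_scale_leq _ _) _.
  by apply: leq_trans (proj1 (hp i)) _; rewrite !ltnS ltnW.
move=> d; rewrite hornerZ hornerD hornerN hornerXn horner_sum.
have tele : (d%:R : rat) ^+ e.+1 =
    \sum_(i < e.+1) (\sum_(j < d) (j%:R : rat) ^+ i) *+ 'C(e.+1, i).
  elim: d => [|d IHd].
    by rewrite expr0n big1 // => i _; rewrite big_ord0 mul0rn.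
  rewrite -addn1 natrD addrC exprDn big_ord_recr /= subnn binn mulr1n expr1n mul1r.
  rewrite -[d%:R ^+ _]/(_ ^+ e.+1) IHd addrC -big_split; apply: eq_bigr => i _ /=.
  by rewrite addn1 big_ord_recr /= mulrnDl expr1n mul1r addrC.
rewrite tele big_ord_recr /= binSn addrAC.
rewrite (eq_bigr (fun i : 'I_e => (p i *+ 'C(e.+1, i)).[d%:R])); last first.
  by move=> i _; rewrite hornerMn (proj2 (hp i)).
by rewrite subrr add0r -[X in _ * X]mulr_natl mulKf ?pnatr_eq0.
Qed.

Lemma box_sum_polynomial (c : bool) e : polyle e.+1
  (fun d => \sum_(j < d.+1 | (0 < j <= d - c)%N) (j%:R : rat) ^+ e).
Proof.
have [p [sp hp]] := power_sum_polynomial e.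
(* The range is [j < d.+1 - c] without [j = 0], whose term [0 ^+ e] is 1 when [e = 0]. *)
exists (p \Po ('X + (1 - c%:R)%:P) - (0 ^+ e)%:P); split=> [|d d0].
  apply: leq_trans (size_polyD _ _) _.
  rewrite size_comp_poly2 ?size_XaddC // size_polyN geq_max sp.
  by apply: leq_trans (size_polyC_leq1 _) _.
rewrite hornerD hornerN hornerC horner_comp hornerD hornerX hornerC.
have -> : d%:R + (1 - c%:R) = ((d.+1 - c)%N)%:R :> rat.
  by rewrite natrB; [rewrite -addn1 natrD addrA | case: c => //; lia].
rewrite -hp.
have le : (d.+1 - c <= d.+1)%N by rewrite leq_subr.
rewrite (big_ord_widen _ (fun j => (j%:R : rat) ^+ e) le).
rewrite [X in _ = X - _](bigD1 ord0) /=; last by case: c {le} => //; lia.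
rewrite [RHS]addrC addKr; apply: eq_bigl => j.
rewrite andbC -lt0n; congr andb; case: c {le}; lia.
Qed.

(** * Multivariate polynomial functions summed over boxes *)

Section MultivariatePolynomialFunctions.
Variable I : finType.

(** A list of coefficients with exponent vectors, repetitions allowed, so that addition is
    concatenation. *)
Definition mpolyle (m : nat) (G : (I -> rat) -> rat) : Prop :=
  exists s : seq (rat * {ffun I -> nat}),
    all (fun t : rat * {ffun I -> nat} => (\sum_i t.2 i <= m)%N) s /\
    forall x, G x = \sum_(t <- s) t.1 * \prod_i x i ^+ t.2 i.

Lemma mpolyle_ext m G1 G2 : G1 =1 G2 -> mpolyle m G1 -> mpolyle m G2.
Proof. by move=> E [s [sm hs]]; exists s; split=> // x; rewrite -E. Qed.

Lemma mpolyleW m1 m2 G : (m1 <= m2)%N -> mpolyle m1 G -> mpolyle m2 G.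
Proof.
move=> m12 [s [sm hs]]; exists s; split=> //.
by apply: sub_all sm => t /= /leq_trans; apply.
Qed.

Lemma mpolyle_const c : mpolyle 0 (fun=> c).
Proof.
exists [:: (c, [ffun=> 0%N])]; split=> [|x].
  by rewrite /= big1 // => i _; rewrite ffunE.
by rewrite big_seq1 big1 ?mulr1 // => i _; rewrite ffunE.
Qed.

Lemma mpolyle_var i : mpolyle 1 (fun x => x i).
Proof.
exists [:: (1, [ffun j => (j == i) : nat])]; split=> [|x].
  rewrite /= andbT (bigD1 i) //= ffunE eqxx big1 // => j /negbTE ji.
  by rewrite ffunE ji.
rewrite big_seq1 mul1r (bigD1 i) //= ffunE eqxx big1 ?mulr1 // => j /negbTE ji.
by rewrite ffunE ji.
Qed.

Lemma mpolyleD m G1 G2 : mpolyle m G1 -> mpolyle m G2 ->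
  mpolyle m (fun x => G1 x + G2 x).
Proof.
move=> [s1 [sm1 h1]] [s2 [sm2 h2]]; exists (s1 ++ s2).
by rewrite all_cat sm1; split=> // x; rewrite big_cat h1 h2.
Qed.

Lemma mpolyleM m1 m2 G1 G2 : mpolyle m1 G1 -> mpolyle m2 G2 ->
  mpolyle (m1 + m2) (fun x => G1 x * G2 x).
Proof.
move=> [s1 [/allP sm1 h1]] [s2 [/allP sm2 h2]].
pose mul (t1 t2 : rat * {ffun I -> nat}) :=
  (t1.1 * t2.1, [ffun i => (t1.2 i + t2.2 i)%N]).
exists [seq mul t1 t2 | t1 <- s1, t2 <- s2].
split=> [|x].
  apply/allP => _ /allpairsP[[t1 t2] /= [/sm1 t1s /sm2 t2s ->]] /=.
  under eq_bigr do rewrite ffunE.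
  by rewrite big_split leq_add.
rewrite h1 h2 big_distrlr /= big_allpairs_dep; apply: eq_bigr => t1 _.
apply: eq_bigr => t2 _ /=; rewrite mulrACA -big_split /=; congr (_ * _).
by apply: eq_bigr => i _; rewrite ffunE exprD.
Qed.

Lemma mpolyleZ c m G : mpolyle m G -> mpolyle m (fun x => c * G x).
Proof. by move=> h; have := mpolyleM (mpolyle_const c) h. Qed.

Lemma mpolyle_exp k m G : mpolyle m G -> mpolyle (m * k) (fun x => G x ^+ k).
Proof.
move=> h; elim: k => [|k IH]; first by rewrite muln0; exact: mpolyle_const.
by rewrite mulnS; apply: mpolyle_ext (mpolyleM h IH) => x; rewrite exprS.
Qed.

Lemma mpolyle_sum m (G : I -> (I -> rat) -> rat) :
  (forall i, mpolyle m (G i)) -> mpolyle m (fun x => \sum_i G i x).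
Proof.
move=> H; elim: (index_enum I) => [|i r IH].
  apply: mpolyle_ext (mpolyleW (leq0n m) (mpolyle_const 0)) => x.
  by rewrite big_nil.
by apply: mpolyle_ext (mpolyleD (H i) IH) => x; rewrite big_cons.
Qed.

(** The sum of a monomial over a box factors into one-variable power sums, and each coordinate in
    [S] raises the degree in [d] by one. A coordinate outside [S] is fixed at 0 and gives a constant
    factor. *)
Lemma mpolyle_family_sum (S : {set I}) (c : I -> bool) m G : mpolyle m G ->
  polyle (m + #|S|) (fun d =>
    \sum_(a : {ffun I -> 'I_d.+1} |
        [forall i, if i \in S then (0 < a i <= d - c i)%N else a i == 0%N :> nat])
      G (fun i => (a i : nat)%:R)).
Proof.
move=> [s [/allP sm hs]].
pose h (t : rat * {ffun I -> nat}) i d : rat := if i \in S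
  then \sum_(j < d.+1 | (0 < j <= d - c i)%N) (j%:R : rat) ^+ t.2 i
  else 0 ^+ t.2 i.
have hp t : t \in s -> polyle (m + #|S|) (fun d => t.1 * \prod_i h t i d).
  move=> /sm tm.
  have H i : polyle (t.2 i + (i \in S)) (h t i).
    rewrite /h; case: (i \in S); first by rewrite addn1; exact: box_sum_polynomial.
    exact: polyleW (leq0n _) (polyle_const _).
  have := polyleM (polyle_const t.1) (polyle_prod (index_enum I) H).
  apply: polyleW; rewrite add0n big_split /= leq_add //.
  by rewrite -sum1_card [leqRHS]big_mkcond /= leq_sum // => i _; case: (i \in S).
have := @polyle_sum _ s (mem s) (m + #|S|) _ hp; apply: polyle_ext => d _.
under [RHS]eq_bigr do rewrite hs.
rewrite exchange_big [RHS]big_seq; apply: eq_bigr => t _ /=.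
rewrite -big_distrr /=; congr (_ * _).
pose Q i : pred 'I_d.+1 :=
  fun j => if i \in S then (0 < j <= d - c i)%N else j == 0%N :> nat.
transitivity (\prod_i \sum_(j | Q i j) ((j : nat)%:R : rat) ^+ t.2 i).
  apply: eq_bigr => i _; rewrite /h /Q; case: ifP => // _.
  by rewrite (big_pred1 ord0).
by rewrite bigA_distr_big_dep; apply: eq_bigl => a.
Qed.

End MultivariatePolynomialFunctions.

End PolynomialSums.

(** * Power sums of core sizes *)

Section CoreSums.
Variable n : nat.

(** The size formula of [sumn_unbeta_beads], with each binomial coefficient replaced by its
    quadratic polynomial so that it makes sense at rational arguments. *)
Definition core_size (x : 'I_n.+1 -> rat) : rat :=
  \sum_i (x i * i%:R + (n.+1%:R / 2) * (x i * (x i - 1)))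
  - 2^-1 * ((\sum_i x i) * (\sum_i x i - 1)).

Lemma natr_bin2 m : 'C(m, 2)%:R = 2^-1 * (m%:R * (m%:R - 1)) :> rat.
Proof.
elim: m => [|m IH]; first by rewrite mul0r mulr0.
by rewrite binS bin1 natrD IH -addn1 natrD; field.
Qed.

Lemma core_sizeE d u (a : {ffun 'I_n.+1 -> 'I_d.+1}) : admissible u a ->
  (sumn (unbeta (beads a)))%:R = core_size (fun i => (a i : nat)%:R).
Proof.
move=> /sumn_unbeta_beads /(congr1 (fun m => m%:R : rat)).
rewrite natrD natr_bin2 !natr_sum => /(canRL (addrK _)) ->.
congr (_ - _); apply: eq_bigr => i _.
by rewrite natrD !natrM natr_bin2; ring.
Qed.

Lemma core_size_mpolynomial : mpolyle 2 core_size.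
Proof.
have subc (G : ('I_n.+1 -> rat) -> rat) c : mpolyle 1 G ->
    mpolyle 1 (fun x => G x - c).
  by move=> h; apply: mpolyleD h (mpolyleW (leq0n _) (mpolyle_const _ _)).
have hS : mpolyle 1 (fun x : 'I_n.+1 -> rat => \sum_i x i).
  by apply: mpolyle_sum => i; exact: mpolyle_var.
rewrite /core_size.
have hq : mpolyle 2 (fun x : 'I_n.+1 -> rat =>
    - 2^-1 * ((\sum_i x i) * (\sum_i x i - 1))).
  by apply/mpolyleZ/(mpolyleM hS)/subc.
have hl : mpolyle 2 (fun x : 'I_n.+1 -> rat =>
    \sum_i (x i * i%:R + (n.+1%:R / 2) * (x i * (x i - 1)))).
  apply: mpolyle_sum => i; apply: mpolyleD.
    apply: (@mpolyleW _ 1) => //.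
    by apply: mpolyle_ext (mpolyleZ i%:R (mpolyle_var i)) => x; rewrite mulrC.
  apply: mpolyleZ; apply: (mpolyleM (mpolyle_var i)); apply: subc.
  exact: mpolyle_var.
by apply: mpolyle_ext (mpolyleD hl hq) => x; rewrite mulNr.
Qed.

(** These are the possible supports of admissible vectors. *)
Definition sparse (S : {set 'I_n.+1}) : bool :=
  (ord0 \notin S) && [forall i : 'I_n.+1, forall j : 'I_n.+1,
    (j == i.+1 :> nat) ==> ~~ ((i \in S) && (j \in S))].

(* The map i |-> (i - 1)/2 is injective on a sparse set avoiding 0. *)
Lemma card_sparse (S : {set 'I_n.+1}) : sparse S -> (#|S| <= n.+1./2)%N.
Proof.
case/andP=> S0 /forallP ns.
rewrite cardE -(size_map (fun i : 'I_n.+1 => i.-1./2)) -[leqRHS](size_iota 0).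
have pos i : i \in S -> (0 < i)%N.
  move=> iS; rewrite lt0n; apply: contraNneq S0 => i0.
  by rewrite -(_ : i = ord0) //; apply/val_inj.
apply: uniq_leq_size.
  rewrite map_inj_in_uniq ?enum_uniq // => i j; rewrite !mem_enum => iS jS E.
  have ne (i1 j1 : 'I_n.+1) : i1 \in S -> j1 \in S -> j1 <> i1.+1 :> nat.
    move=> h1 h2 /eqP e; have /forallP/(_ j1) := ns i1.
    by rewrite e h1 h2.
  have := ne _ _ iS jS; have := ne _ _ jS iS; have := pos _ iS; have := pos _ jS.
  by move=> ? ? ? ?; apply/val_inj => /=; lia.
move=> _ /mapP[i + ->]; rewrite mem_enum mem_iota add0n => /pos i0.
have := ltn_ord i; lia.
Qed.

(** Group the vectors by support. The sparse supports do not depend on [d], and the admissible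
    vectors with a given one form a box, of side shortened by one on runner [n] when [u] holds. *)
Lemma admissible_sum_polynomial (u : bool) m (G : ('I_n.+1 -> rat) -> rat) :
  mpolyle m G -> polyle (m + n.+1./2) (fun d =>
    \sum_(a : {ffun 'I_n.+1 -> 'I_d.+1} | admissible u a)
      G (fun i => (a i : nat)%:R)).
Proof.
move=> hG; pose c (i : 'I_n.+1) := u && (i == n :> nat).
have := @polyle_sum _ (index_enum _) sparse (m + n.+1./2)
  (fun S d => \sum_(a : {ffun 'I_n.+1 -> 'I_d.+1} | [forall i,
      if i \in S then (0 < a i <= d - c i)%N else a i == 0%N :> nat])
      G (fun i => (a i : nat)%:R)) _.
move=> /(_ _)/polyle_ext; apply=> [|S Ss]; last first.
  by apply: polyleW (mpolyle_family_sum S c hG); rewrite leq_add2l card_sparse.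
move=> d d0.
pose supp (a : {ffun 'I_n.+1 -> 'I_d.+1}) := [set i | (0 < a i)%N].
rewrite [RHS](partition_big supp sparse) => [|a /admissibleP[a0 as_ _]]; last first.
  apply/andP; split; first by rewrite inE a0.
  apply/forallP => i; apply/forallP => j; apply/implyP => /eqP ij.
  by rewrite !inE; apply/negP => /andP[]; apply: as_.
apply: eq_bigr => S /andP[S0 /forallP ns]; apply: eq_bigl => a.
apply/forallP/andP => [H|[/admissibleP[_ _ ab] /eqP <-] i]; last first.
  by rewrite inE -/(c i); case: posnP => // _; exact: ab.
have pS i : (0 < a i)%N = (i \in S).
  by have := H i; case: ifP => _ => [/andP[]|/eqP->].
split; last by apply/eqP/setP => i; rewrite inE.
apply/admissibleP; split=> [|i j /eqP ij|i].
- by apply/eqP; rewrite eqn0Ngt pS.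
- by rewrite !pS => iS jS; have /forallP/(_ j) := ns i; rewrite ij iS jS.
- by have := H i; case: ifP => _ => [/andP[]|/eqP->].
Qed.

(** Serves both to rewrite the sum over cores and to prove that the set is finite. *)
Lemma distinct_cores_enum d u : (0 < d)%N ->
  distinct_cores n.+1 (modulus n d u) =
  [set` [seq unbeta (beads a) | a <- enum (@admissible n d u)]]%classic.
Proof.
move=> d0; apply/seteqP; split=> la /=.
  case/(core_beads d0) => a aa E; apply/mapP; exists a; first by rewrite mem_enum.
  by rewrite -E betaK.
by case/mapP => a; rewrite mem_enum => aa ->; apply: beads_core.
Qed.

Lemma unbeta_beads_inj d u :
  {in admissible u &, injective (fun a : {ffun 'I_n.+1 -> 'I_d.+1} => unbeta (beads a))}.
Proof.
move=> a b aa ab /(congr1 beta).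
by rewrite !unbetaK ?sorted_beads ?(beads_pos aa) ?(beads_pos ab) //; apply: beads_inj.
Qed.

Lemma distinct_cores_sum d u k : (0 < d)%N ->
  \sum_(la \in distinct_cores n.+1 (modulus n d u)) ((sumn la)%:R : rat) ^+ k =
  \sum_(a : {ffun 'I_n.+1 -> 'I_d.+1} | admissible u a)
    core_size (fun i => (a i : nat)%:R) ^+ k.
Proof.
move=> d0; rewrite distinct_cores_enum // -fsbig_seq; last first.
  rewrite map_inj_in_uniq ?enum_uniq // => a b; rewrite !mem_enum.
  exact: unbeta_beads_inj.
rewrite big_map big_enum; apply: eq_bigr => a aa.
by rewrite (core_sizeE aa).
Qed.

Lemma distinct_cores_sum_polynomial u k : exists p : {poly rat},
  (size p <= (2 * k + n.+1./2).+1)%N /\ forall d : nat, (0 < d)%N ->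
    \sum_(la \in distinct_cores n.+1 (modulus n d u)) ((sumn la)%:R : rat) ^+ k
      = p.[d%:R].
Proof.
have := admissible_sum_polynomial u (mpolyle_exp k core_size_mpolynomial).
by move=> [p [sp hp]]; exists p; split=> // d d0; rewrite distinct_cores_sum ?hp.
Qed.

End CoreSums.

Theorem theorem1p6 (n k : nat) (hn : (0 < n)%N) (hk : (0 < k)%N) :
  (forall d : nat, (0 < d)%N ->
     finite_set (distinct_cores n (d * n + 1)) /\
     finite_set (distinct_cores n (d * n - 1))) /\
  (exists p : {poly rat}, (size p <= (2 * k + n./2).+1)%N /\
     forall d : nat, (0 < d)%N ->
       \sum_(la \in distinct_cores n (d * n + 1)) ((sumn la)%:R : rat) ^+ k
         = p.[d%:R]) /\
  (exists q : {poly rat}, (size q <= (2 * k + n./2).+1)%N /\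
     forall d : nat, (0 < d)%N ->
       \sum_(la \in distinct_cores n (d * n - 1)) ((sumn la)%:R : rat) ^+ k
         = q.[d%:R]).
Proof.
case: n hn => // n _; split=> [d d0|].
  split.
    (* Finiteness ensures that the sums are genuine, not the default value of a sum with infinite
       support. *)
    by have := distinct_cores_enum n false d0; rewrite /modulus => ->; apply: finite_seq.
  by have := distinct_cores_enum n true d0; rewrite /modulus => ->; apply: finite_seq.
split; first exact: distinct_cores_sum_polynomial n false k.
exact: distinct_cores_sum_polynomial n true k.
Qed.
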